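(* Every local SUSP $P$ is a simplifiable SUSP.
   Context: Puzzles. For $s,k\in\mathbb{N}$, an $(s,k)$-puzzle is a subset $P\subseteq\{1,2,3\}^k$ with $|P|=s$. Local SUSP. An $(s,k)$-puzzle $P$ is a local SUSP (local strong uniquely solvable puzzle) if for each $(u,v,w)\in P^3$ with $u,v,w$ not all equal there exists $c\in\{1,\dots,k\}$ such that $(u_c,v_c,w_c)\in\{(1,2,1),(1,2,2),(1,1,3),(1,3,3),(2,2,3),(3,2,3)\}$. 3D graphs. A 3D graph $H$ with finite domain $U$ is given by an edge set $E(H)\subseteq U^3$ (a 3-uniform hypergraph on three disjoint copies of $U$). Its projections are the 2D graphs $R_0,R_1,R_2$ on $U$ with edge sets $E(R_0)=\{(v,w): \exists u,\ (u,v,w)\in E(H)\}$, $E(R_1)=\{(u,w):\exists v,\ (u,v,w)\in E(H)\}$, $E(R_2)=\{(u,v):\exists w,\ (u,v,w)\in E(H)\}$. The trivial matching on $U$ is $\{(u,u,u):u\in U\}$. Simplification. Let $S\subseteq U$ and $f\in\{0,1,2\}$. $S$ induces a simplification of $R_f$ if $E(R_f)\cap (S\times(U\setminus S))=\emptyset$ or $E(R_f)\cap((U\setminus S)\times S)=\emptyset$. In that case the simplification of $H$ induced by $S$ via $R_f$ is the 3D graph obtained from $H$ by deleting every edge whose projection to $R_f$ (i.e. the pair obtained by dropping the first, second, or third coordinate for $f=0,1,2$ respectively) lies in $(S\times(U\setminus S))\cup((U\setminus S)\times S)$. $H$ simplifies to $H'$ if there is a finite (possibly empty) sequence $H=H_0,H_1,\dots,H_\ell=H'$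 and pairs $(S_j,f_j)$ such that $H_j$ is the simplification of $H_{j-1}$ induced by $S_j$ via the projection $R_{f_j}$ of $H_{j-1}$, for each $1\le j\le \ell$ (projections are recomputed at each step). The graph $H_P$. For a puzzle $P\subseteq\{1,2,3\}^k$, $H_P$ is the 3D graph with domain $P$ in which $(u,v,w)\in P^3$ is an edge if and only if there is no $i\in\{1,\dots,k\}$ such that exactly two of the conditions $u_i=1$, $v_i=2$, $w_i=3$ hold. Simplifiable SUSP. A puzzle $P$ is a simplifiable SUSP if $H_P$ simplifies to the 3D graph whose edge set is the trivial matching $\{(u,u,u):u\in P\}$. *)

(* Defs.v *)
From mathcomp Require Import all_boot.

Set Implicit Arguments.
Unset Strict Implicit.
Unset Printing Implicit Defensive.

(* {1,2,3}^k is encoded by functions into 'I_3 = {0,1,2}: the symbol stored as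
   i : 'I_3 stands for i + 1, which is what [symb] returns. *)
Definition word (k : nat) : finType := {ffun 'I_k -> 'I_3}.

Definition symb (k : nat) (u : word k) (c : 'I_k) : nat := (u c).+1.

Definition is_puzzle (s k : nat) (P : {set word k}) : Prop := #|P| = s.

Definition local_SUSP (k : nat) (P : {set word k}) : Prop :=
  forall u v w : word k,
    u \in P -> v \in P -> w \in P -> ~ (u = v /\ v = w) ->
    exists c : 'I_k,
      (symb u c, symb v c, symb w c)
        \in [:: (1, 2, 1); (1, 2, 2); (1, 1, 3);
                (1, 3, 3); (2, 2, 3); (3, 2, 3)].

(* A 3D graph with domain U is identified with its edge set. *)
Definition graph3 (U : finType) : finType := {set U * U * U}.

Definition trivial_matching (U : finType) : graph3 U :=
  [set (u, u, u) | u : U].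

(* The pair left after dropping the coordinate of index f (0, 1 or 2). *)
Definition drop_coord (U : finType) (f : 'I_3) (e : U * U * U) : U * U :=
  let: (u, v, w) := e in
  match val f with
  | 0 => (v, w)
  | 1 => (u, w)
  | _ => (u, v)
  end.

Definition projection (U : finType) (f : 'I_3) (H : graph3 U) : {set U * U} :=
  [set drop_coord f e | e in H].

Definition induces_simplification
    (U : finType) (S : {set U}) (R : {set U * U}) : bool :=
  (R :&: setX S (~: S) == set0) || (R :&: setX (~: S) S == set0).

Definition simplification
    (U : finType) (H : graph3 U) (S : {set U}) (f : 'I_3) : graph3 U :=
  [set e in H | drop_coord f e \notin setX S (~: S) :|: setX (~: S) S].

Definition simplification_step (U : finType) : rel (graph3 U) :=
  fun H H' =>
    [exists S : {set U}, exists f : 'I_3,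
      induces_simplification S (projection f H)
        && (H' == simplification H S f)].

(* Hs lists H_1, ..., H_l; the empty list is the case l = 0. *)
Definition simplifies_to (U : finType) (H H' : graph3 U) : Prop :=
  exists2 Hs : seq (graph3 U),
    path (@simplification_step U) H Hs & H' = last H Hs.

Definition puzzle_dom (k : nat) (P : {set word k}) : finType :=
  {u : word k | u \in P}.

Definition puzzle_graph (k : nat) (P : {set word k}) : graph3 (puzzle_dom P) :=
  [set e : puzzle_dom P * puzzle_dom P * puzzle_dom P |
    let: (u, v, w) := e in
    ~~ [exists i : 'I_k,
          count id [:: symb (val u) i == 1;
                       symb (val v) i == 2;
                       symb (val w) i == 3] == 2]].

Definition simplifiable_SUSP (k : nat) (P : {set word k}) : Prop :=
  simplifies_to (puzzle_graph P) (trivial_matching (puzzle_dom P)).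

(* Main.v *)
(* The six triples of the local condition are exactly those satisfying two of
   u_c = 1, v_c = 2, w_c = 3, so a local SUSP has no edge (u, v, w) with
   u, v, w not all equal. At a diagonal triple exactly one of the three
   conditions holds in each coordinate. Hence the graph is already the trivial
   matching, and the empty sequence of simplifications suffices. *)
Require Import Defs.
From mathcomp Require Import all_boot.

Lemma local_SUSP_puzzle_graph (k : nat) (P : {set word k}) :
  local_SUSP P -> puzzle_graph P = trivial_matching (puzzle_dom P).
Proof.
move=> locP; apply/setP => -[[u v] w]; rewrite inE.
apply/idP/imsetP => [edge | [x _ [-> -> ->]]]; last first.
  apply/existsPn => i; rewrite /symb.
  (* Whichever of its three values the common symbol takes, the count evaluates to 1. *)
  by case: (val x i) => -[|[|[|]]].
have [/andP[/eqP uv /eqP vw] | neq] := boolP ((u == v) && (v == w)).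
  by exists u; rewrite // -vw -uv.
have [|c] := locP _ _ _ (valP u) (valP v) (valP w).
  (* [locP] compares the underlying words, whereas [neq] compares vertices of the subtype;
     injectivity of [val] bridges the two. *)
  by case=> /val_inj uv /val_inj vw; rewrite uv vw !eqxx in neq.
move/existsPn: edge => /(_ c) /=; rewrite !inE.
(* One case per listed triple: substituting its symbols makes the count evaluate to 2, which [two]
   forbids. *)
by move=> two /or4P[|||/or3P[]] /eqP[ui vi wi]; rewrite /symb ui vi wi in two.
Qed.

Theorem lemma7 (s k : nat) (P : {set word k}) :
  is_puzzle s P -> local_SUSP P -> simplifiable_SUSP P.
Proof.
by move=> _ /local_SUSP_puzzle_graph graphP; exists [::].
Qed.
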